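(* Suppose Assumption (A1) holds and there exists $\epsilon>0$ such that $$1-L_{k-1}-L_k-2\gamma_kL_k\mu-\gamma_k^2\mu^2-\frac{\gamma_k\beta}{2}\ge\epsilon\quad\text{for all integers }k\ge1.$$ Then, for any $x_0,u_0\in\mathcal H$, the sequence $\{x_k\}_{k\in\mathbb N}$ generated by Algorithm NFBHF-M converges weakly to a point in $\operatorname{zer}(A+B+C)$.
   Context: $\mathcal H$ is a real Hilbert space. $\mathcal P(\mathcal H)$ denotes the set of bounded linear operators $S:\mathcal H\to\mathcal H$ that are self-adjoint and strongly positive ($\langle Sx,x\rangle\ge m\|x\|^2$ for some $m>0$ and all $x$); for such $S$, $S^{-1}\in\mathcal P(\mathcal H)$, $\langle x,y\rangle_S:=\langle Sx,y\rangle$ and $\|x\|_S:=\sqrt{\langle Sx,x\rangle}$. For $S\in\mathcal P(\mathcal H)$, a single-valued $T:\mathcal H\to\mathcal H$ is $L$-Lipschitz continuous w.r.t. $S$ if $\|Tx-Ty\|_{S^{-1}}\le L\|x-y\|_S$ for all $x,y$, and is $\beta^{-1}$-cocoercive w.r.t. $S$ ($\beta>0$) if $\langle Tx-Ty,x-y\rangle\ge \beta^{-1}\|Tx-Ty\|_{S^{-1}}^2$ for all $x,y$. $\operatorname{zer}(A+B+C)=\{x\in\mathcal H: 0\in Ax+Bx+Cx\}$. Assumption (A1): fix $S\in\mathcal P(\mathcal H)$. (i) $A:\mathcal H\to2^{\mathcal H}$ is maximally monotone; (ii) $B:\mathcal H\to\mathcal H$ is single-valued, monotone and $\mu$-Lipschitz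 continuous w.r.t. $S$ ($\mu\ge0$); (iii) $C:\mathcal H\to\mathcal H$ is $\beta^{-1}$-cocoercive w.r.t. $S$ for some $\beta>0$; (iv) $\operatorname{zer}(A+B+C)\neq\emptyset$; (v) there is $\gamma>0$ and, for each $k\in\mathbb N$, a step-size $\gamma_k\ge\gamma$, a constant $L_k\in[0,1)$ and a (possibly nonlinear) operator $M_k:\mathcal H\to\mathcal H$ such that $\gamma_kM_k-S$ is $L_k$-Lipschitz continuous w.r.t. $S$. (Under (v), $M_k$ is maximally monotone and strongly monotone, so $(M_k+A)^{-1}$ is single-valued with full domain.) Algorithm NFBHF-M: given $x_0,u_0\in\mathcal H$, for $k=0,1,2,\dots$ $$y_k=(M_k+A)^{-1}\big(M_kx_k-(B+C)x_k+\gamma_k^{-1}u_k\big),\quad x_{k+1}=y_k-\gamma_kS^{-1}By_k+\gamma_kS^{-1}Bx_k,\quad u_{k+1}=(\gamma_kM_k-S)y_k-(\gamma_kM_k-S)x_k.$$ *)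

(* Defs.v *)
From mathcomp Require Import all_boot all_algebra all_classical all_reals all_analysis.
Import GRing.Theory Num.Theory numFieldNormedType.Exports.
Set Implicit Arguments. Unset Strict Implicit. Unset Printing Implicit Defensive.
Local Open Scope classical_set_scope.
Local Open Scope ring_scope.

Section Hilbert.
Variables (R : realType) (V : lmodType R) (inner : V -> V -> R).

Definition inner_product : Prop :=
  [/\ (forall x y, inner x y = inner y x),
      (forall a x y z, inner (a *: x + y) z = a * inner x z + inner y z),
      (forall x, 0 <= inner x x) &
      (forall x, inner x x = 0 -> x = 0)].

Definition hnorm (x : V) : R := Num.sqrt (inner x x).

Definition hcomplete : Prop :=
  forall u : nat -> V,
    (forall e : R, 0 < e -> exists N : nat, forall m n : nat,
        (N <= m)%N -> (N <= n)%N -> hnorm (u m - u n) < e) ->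
    exists l : V, forall e : R, 0 < e -> exists N : nat, forall n : nat,
        (N <= n)%N -> hnorm (u n - l) < e.

Definition hilbert_space : Prop := inner_product /\ hcomplete.

Definition bounded_linear (S : V -> V) : Prop :=
  (forall a x y, S (a *: x + y) = a *: S x + S y) /\
  exists c : R, forall x, hnorm (S x) <= c * hnorm x.

Definition self_adjoint (S : V -> V) : Prop :=
  forall x y, inner (S x) y = inner x (S y).

Definition strongly_positive (S : V -> V) : Prop :=
  exists m : R, 0 < m /\ forall x, m * hnorm x ^+ 2 <= inner (S x) x.

Definition in_P (S : V -> V) : Prop :=
  [/\ bounded_linear S, self_adjoint S & strongly_positive S].

Definition Snorm (S : V -> V) (x : V) : R := Num.sqrt (inner (S x) x).

Definition lipschitz_wrt (S Sinv : V -> V) (L : R) (T : V -> V) : Prop :=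
  forall x y, Snorm Sinv (T x - T y) <= L * Snorm S (x - y).

Definition cocoercive_wrt (Sinv : V -> V) (beta : R) (T : V -> V) : Prop :=
  forall x y, beta^-1 * Snorm Sinv (T x - T y) ^+ 2 <= inner (T x - T y) (x - y).

Definition monotone_setop (A : V -> set V) : Prop :=
  forall x y u v, A x u -> A y v -> 0 <= inner (x - y) (u - v).

Definition maximally_monotone (A : V -> set V) : Prop :=
  monotone_setop A /\
  forall A' : V -> set V, monotone_setop A' ->
    (forall x u, A x u -> A' x u) -> forall x u, A' x u -> A x u.

Definition monotone_op (B : V -> V) : Prop :=
  forall x y, 0 <= inner (B x - B y) (x - y).

Definition zer3 (A : V -> set V) (B C : V -> V) : set V :=
  [set x | exists a, A x a /\ a + B x + C x = 0].

Definition weak_cvg (x : nat -> V) (z : V) : Prop :=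
  forall w : V, (fun k => inner (x k) w) @ \oo --> inner z w.

(** y = (M + A)^{-1} w,  i.e.  w \in M y + A y *)
Definition resolvent_point (M : V -> V) (A : V -> set V) (w y : V) : Prop :=
  A y (w - M y).

Definition NFBHF_M (Sinv : V -> V) (A : V -> set V) (B C : V -> V)
  (gam : nat -> R) (M : nat -> V -> V) (S : V -> V)
  (x0 u0 : V) (x y u : nat -> V) : Prop :=
  [/\ x 0%N = x0, u 0%N = u0 &
   forall k : nat,
     [/\ resolvent_point (M k) A
           (M k (x k) - (B (x k) + C (x k)) + (gam k)^-1 *: u k) (y k),
         x k.+1 = y k - gam k *: Sinv (B (y k)) + gam k *: Sinv (B (x k)) &
         u k.+1 = (gam k *: M k (y k) - S (y k)) - (gam k *: M k (x k) - S (x k))]].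

End Hilbert.

(* Main.v *)
(** Passing to the inner product <Sx, y> and replacing A, B, C, u_k by their images
    under S^-1 reduces everything to the case S = id. For a zero z, the quantity
      phi_k = |x_k - z|^2 + 2 <u_k, x_k - z> + L_{k-1} |y_{k-1} - x_{k-1}|^2
    dominates eps |x_k - z|^2 and satisfies phi_{k+1} <= phi_k - eps |y_k - x_k|^2,
    so y_k - x_k -> 0, u_k -> 0 and |x_k - z| converges. Weak limits of x_k along an
    ultrafilter are zeros by demiclosedness, and all of them coincide by Opial's
    argument. *)
Require Import Defs.
From mathcomp Require Import all_boot all_algebra all_classical all_reals all_analysis.
From mathcomp Require Import order ring lra.
Import Order.TTheory GRing.Theory Num.Theory numFieldNormedType.Exports.
Local Open Scope classical_set_scope.
Local Open Scope ring_scope.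
Set Implicit Arguments. Unset Strict Implicit. Unset Printing Implicit Defensive.

(** * Inner-product calculus and Riesz representation *)

Section InnerProduct.
Variables (R : realType) (V : lmodType R) (ip : V -> V -> R).
Hypothesis ipH : inner_product ip.
Local Notation N := (hnorm ip).

Lemma ipC x y : ip x y = ip y x. Proof. by case: ipH. Qed.

Lemma ip_linear a x y z : ip (a *: x + y) z = a * ip x z + ip y z.
Proof. by case: ipH. Qed.

Lemma ip_ge0 x : 0 <= ip x x. Proof. by case: ipH. Qed.

Lemma ip_eq0 x : ip x x = 0 -> x = 0. Proof. by case: ipH => _ _ _; exact. Qed.

Lemma ip0l y : ip 0 y = 0.
Proof. by have := ip_linear 1 0 0 y; rewrite scale1r addr0; lra. Qed.

Lemma ipDl x y z : ip (x + y) z = ip x z + ip y z.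
Proof. by have := ip_linear 1 x y z; rewrite scale1r mul1r. Qed.

Lemma ipZl a x y : ip (a *: x) y = a * ip x y.
Proof. by have := ip_linear a x 0 y; rewrite ip0l !addr0. Qed.

Lemma ipNl x y : ip (- x) y = - ip x y.
Proof. by rewrite -scaleN1r ipZl mulN1r. Qed.

Lemma ip0r y : ip y 0 = 0. Proof. by rewrite ipC ip0l. Qed.

Lemma ipDr x y z : ip z (x + y) = ip z x + ip z y.
Proof. by rewrite !(ipC z) ipDl. Qed.

Lemma ipZr a x y : ip y (a *: x) = a * ip y x.
Proof. by rewrite !(ipC y) ipZl. Qed.

Lemma ipNr x y : ip y (- x) = - ip y x.
Proof. by rewrite !(ipC y) ipNl. Qed.

Definition ipE := (ip0l, ip0r, ipDl, ipDr, ipZl, ipZr, ipNl, ipNr).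

Lemma ip_ext x y : (forall z, ip x z = ip y z) -> x = y.
Proof.
by move=> xy; apply/subr0_eq/ip_eq0; rewrite ipDl ipNl xy subrr.
Qed.

Lemma hnorm_ge0 x : 0 <= N x. Proof. exact: sqrtr_ge0. Qed.

Lemma hnorm_sqr x : N x ^+ 2 = ip x x. Proof. by rewrite sqr_sqrtr// ip_ge0. Qed.

Lemma hnormN x : N (- x) = N x.
Proof. by rewrite /hnorm ipNl ipNr opprK. Qed.

Lemma hnorm_distC x y : N (x - y) = N (y - x).
Proof. by rewrite -hnormN opprB. Qed.

Lemma hnormZ a x : N (a *: x) = `|a| * N x.
Proof.
by rewrite /hnorm ipZl ipZr mulrA -expr2 sqrtrM ?sqr_ge0// sqrtr_sqr.
Qed.

Lemma cauchy_schwarz x y : `|ip x y| <= N x * N y.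
Proof.
rewrite -ler_sqr ?nnegrE ?mulr_ge0 ?hnorm_ge0// real_normK ?num_real//.
rewrite exprMn !hnorm_sqr.
have := ip_ge0 y; rewrite le0r => /orP[/eqP/ip_eq0 ->|y0].
  by rewrite !ipE expr0n mulr0.
(* This squared norm expands to [<y,y>] times the defect [<x,x><y,y> - <x,y>^2]. *)
have := ip_ge0 (ip y y *: x - ip x y *: y).
rewrite !ipE (ipC y x) => h.
rewrite -(ler_pM2l y0) -subr_ge0; move: h; congr (_ <= _); ring.
Qed.

Lemma ip_le x y : ip x y <= N x * N y.
Proof. exact: le_trans (ler_norm _) (cauchy_schwarz x y). Qed.

Lemma ip_ge x y : - (N x * N y) <= ip x y.
Proof. by have := cauchy_schwarz x y; rewrite ler_norml => /andP[]. Qed.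

Lemma ler_hnormD x y : N (x + y) <= N x + N y.
Proof.
rewrite -ler_sqr ?nnegrE ?addr_ge0 ?hnorm_ge0// sqrrD !hnorm_sqr !ipE.
by rewrite (ipC y x); have := ip_le x y; lra.
Qed.

Lemma ler_hnormB x y : N (x - y) <= N x + N y.
Proof. by rewrite -[X in _ <= _ + X]hnormN; exact: ler_hnormD. Qed.

(* Minty's trick: the first-order coefficient of a nonnegative quadratic vanishes. *)
Lemma quadratic_ge0_linear0 (a b : R) :
  0 <= a -> (forall t, 0 <= t ^+ 2 * a + t * b) -> b = 0.
Proof.
move=> a0 h; have a1 : 0 < a + 1 by lra.
have a1' : a + 1 != 0 by lra.
(* Near the minimiser [t]; the denominator [a + 1] also covers [a = 0], and the quadratic takes the
   value [- (b / (a + 1))^2]. *)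
have := h (- b / (a + 1)).
have -> : (- b / (a + 1)) ^+ 2 * a + - b / (a + 1) * b
   = - (b / (a + 1)) ^+ 2 by field.
rewrite oppr_ge0 => b0; have /eqP : (b / (a + 1)) ^+ 2 = 0.
  by apply/eqP; rewrite eq_le b0 sqr_ge0.
by rewrite sqrf_eq0 mulf_eq0 invr_eq0 (negbTE a1') orbF => /eqP.
Qed.

Hypothesis ip_complete : hcomplete ip.

(* The representing vector minimises [ip v v - 2 * f v]; minimising sequences are
   Cauchy by the parallelogram law. *)
Lemma riesz (f : V -> R) (K : R) :
  (forall a x y, f (a *: x + y) = a * f x + f y) ->
  (forall x, `|f x| <= K * N x) ->
  exists l, forall w, f w = ip l w.
Proof.
move=> fL fK.
have f0 : f 0 = 0 by have := fL 1 0 0; rewrite scale1r addr0; lra.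
have fD x y : f (x + y) = f x + f y.
  by have := fL 1 x y; rewrite scale1r mul1r.
have fZ a x : f (a *: x) = a * f x by have := fL a x 0; rewrite !addr0 f0 addr0.
have fN x : f (- x) = - f x by rewrite -scaleN1r fZ mulN1r.
have fle x : f x <= K * N x by apply: le_trans (fK x); exact: ler_norm.
pose J v := ip v v - 2 * f v.
have JlbK v : - K ^+ 2 <= J v.
  have := fle v; have := sqr_ge0 (N v - K); rewrite /J -hnorm_sqr; nra.
have hinf : has_inf (range J).
  split; first by exists (J 0), 0.
  by exists (- K ^+ 2) => _ [v _ <-].
pose m := inf (range J).
have Jm v : m <= J v.
  by apply: ge_inf; [case: hinf | exists v].
have /choice[v vP] (n : nat) : exists v, J v < m + n.+1%:R^-1.
  have n0 : 0 < n.+1%:R^-1 :> R by rewrite invr_gt0 ltr0n.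
  by have [_ [v _ <-] ?] := inf_adherent n0 hinf; exists v.
have vlt (e : R) n : n.+1%:R^-1 < e -> J (v n) < m + e.
  by move=> h; apply: lt_trans (vP n) _; rewrite ltrD2l.
(* The squared distance equals [2 J x + 2 J y - 4 J ((x + y) / 2)], and [J] at the midpoint is at
   least [m]. *)
have par x y : N (x - y) ^+ 2 <= 2 * (J x + J y - 2 * m).
  have := Jm (2^-1 *: (x + y)).
  rewrite /J hnorm_sqr !ipE !(fZ, fD) (ipC y x) => h; lra.
have small (e : R) : 0 < e -> exists n0 : nat, forall n, (n0 <= n)%N -> n.+1%:R^-1 < e.
  move=> e0; have := @near_infty_natSinv_lt R (PosNum e0).
  by case=> n0 _ h; exists n0 => n; exact: h.
have [|l lP] := @ip_complete v.
  move=> e e0; have [n0 hn0] := small (e ^+ 2 / 4) (divr_gt0 (exprn_gt0 _ e0) (ltr0n _ 4)).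
  exists n0 => p q /hn0 hp /hn0 hq.
  rewrite -ltr_sqr ?nnegrE ?hnorm_ge0 ?ltW// (le_lt_trans (par _ _))//.
  by move: (vlt _ _ hp) (vlt _ _ hq); lra.
have Jl : J l <= m.
  apply/ler_addgt0Pr => e e0.
  (* [J l - J v] is at most [2 (|K| + N l)] times the distance from [v] to [l]; the extra 1 makes
     the divisor positive. Half of [e] pays for this, half for the gap between [J (v n)] and [m]. *)
  have K0 : 0 < `|K| + N l + 1 by have := hnorm_ge0 l; have := normr_ge0 K; lra.
  have d0 : 0 < e / 2 / (2 * (`|K| + N l + 1)) by rewrite !divr_gt0// mulr_gt0.
  have [n1 h1] := lP _ d0.
  have [n2 h2] := small _ (divr_gt0 e0 (ltr0n _ 2)).
  have := h1 _ (leq_maxl n1 n2); have := h2 _ (leq_maxr n1 n2).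
  move: (maxn _ _) => n /vlt hJ hd.
  have : J l - J (v n) <= 2 * (`|K| + N l + 1) * N (v n - l).
    have -> : J l - J (v n) = - ip (v n - l) (v n - l) + 2 * ip l (l - v n) - 2 * f (l - v n).
      by rewrite /J !ipE !(fD, fN) (ipC (v n) l); ring.
    rewrite -hnorm_sqr [in X in _ <= X]hnorm_distC (hnorm_distC (v n)).
    have := ip_le l (l - v n); have := fK (l - v n); rewrite ler_norml => /andP[+ _].
    have := hnorm_ge0 (l - v n); have := ler_norm K; have := sqr_ge0 (N (l - v n)); nra.
  move: hd; rewrite ltr_pdivlMr ?mulr_gt0// mulrC => hd; lra.
exists l => w.
(* First-order optimality at [l]: this is the linear coefficient of [J (l + t w) - J l] in [t]. *)
have : 2 * (ip l w - f w) = 0.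
  apply: (@quadratic_ge0_linear0 (ip w w)); first exact: ip_ge0.
  move=> t; have := Jm (l + t *: w); move: Jl.
  by rewrite /J !ipE !(fD, fZ) (ipC w l); lra.
by lra.
Qed.

End InnerProduct.

(** * Weak limits along filters, demiclosedness and Opial's lemma *)

Section WeakLimits.
Variables (R : realType) (V : lmodType R) (ip : V -> V -> R).
Hypothesis ipH : hilbert_space ip.
Local Notation N := (hnorm ip).
Local Notation ipE := (ipE ipH.1).

(** The filter is arbitrary so that ultrafilters can take the place of subsequences. *)
Definition weak_lim (F : set_system nat) (v : nat -> V) (l : V) : Prop :=
  forall w, ip (v n) w @[n --> F] --> ip l w.

(** Each [<v n, w>] lies in a compact segment, hence converges along [U]; the limit is linear and
    bounded in [w], so Riesz represents it by a vector. *)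
Lemma ultra_weak_lim (U : set_system nat) (v : nat -> V) (K : R) :
  UltraFilter U -> (forall n, N (v n) <= K) -> exists l, weak_lim U v l.
Proof.
move=> UU vK.
have bnd w n : `|ip (v n) w| <= K * N w.
  by rewrite (le_trans (cauchy_schwarz ipH.1 _ _))// ler_wpM2r// hnorm_ge0.
have /choice[f fP] w : exists l : R, ip (v n) w @[n --> U] --> l.
  have := @segment_compact R (- (K * N w)) (K * N w).
  rewrite compact_ultra => /(_ (ip (v n) w @[n --> U])).
  case.
  - split; first exact: fmap_proper_filter.
    (* The image of an ultrafilter is maximal: if the preimage of [P] is not in [U], that of its
       complement is, which contradicts [P] being in the proper filter [G]. *)
    move=> G PG UG; apply/seteqP; split => // P GP.
    case: (in_ultra_setVsetC ((fun n => ip (v n) w) @^-1` P) UU) => // h.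
    have : G (~` P) by exact: UG.
    by move=> /(filterI GP); rewrite setICr => /filter_not_empty.
  - by apply: nearW => n /=; rewrite in_itv/= -ler_norml.
  - by move=> l [_ lP]; exists l.
have [a x y|w|l lP] := @riesz _ _ _ ipH.1 ipH.2 f K.
- apply: (cvg_unique (@norm_hausdorff _ R) (fP _)).
  have -> : (fun n => ip (v n) (a *: x + y)) = (fun n => a * ip (v n) x + ip (v n) y).
    by apply/funext => n; rewrite !ipE.
  by apply: cvgD; [apply: cvgMl_tmp|]; exact: fP.
- rewrite ler_norml; apply/andP; split.
    apply: (cvgr_to_ge (fP w)); apply: nearW => n.
    by have := bnd w n; rewrite ler_norml => /andP[].
  apply: (cvgr_to_le (fP w)); apply: nearW => n.
  by have := bnd w n; rewrite ler_norml => /andP[].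
by exists l => w; rewrite -lP; exact: fP.
Qed.

Lemma ip_cvg0 (F : set_system nat) (r s : nat -> V) (K : R) : Filter F ->
  N (r n) @[n --> F] --> (0 : R) -> (forall n, N (s n) <= K) ->
  ip (r n) (s n) @[n --> F] --> (0 : R).
Proof.
move=> FF r0 sK; apply: norm_cvg0.
apply: (@squeeze_cvgr _ _ _ _ (fun=> 0) (fun n => N (r n) * K)).
- apply: nearW => n; rewrite normr_ge0/= (le_trans (cauchy_schwarz ipH.1 _ _))//.
  by rewrite ler_wpM2l// hnorm_ge0.
- exact: cvg_cst.
- by rewrite -(mul0r K); apply: cvgMr_tmp.
Qed.

(** Adding the single pair [(p, v)] to the graph keeps it monotone, so maximality says it was
    already there. *)
Lemma maximal_mem (A : V -> set V) p v : maximally_monotone ip A ->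
  (forall q b, A q b -> 0 <= ip (q - p) (b - v)) -> A p v.
Proof.
move=> [Am AM] h.
apply: (AM (fun q b => A q b \/ (q = p /\ b = v))); [|by left|by right].
move=> q q' b b' [Aq|[-> ->]] [Aq'|[-> ->]].
- exact: Am.
- exact: h.
- by have := h _ _ Aq'; rewrite !ipE; lra.
- by rewrite !subrr !ipE.
Qed.

(* Minty's theorem is not needed: monotonicity of D gives
   liminf <y_n - p, D y_n> >= 0, hence limsup <y_n - p, a_n> <= 0, so that
   (p, - d) lies in the graph of A; monotonicity of A at (p, - d) then forces
   limsup <y_n - p, D y_n> <= 0, whence d = D p. *)
Lemma demiclosed (U : set_system nat) (A : V -> set V) (D : V -> V) (l K : R)
    (y a : nat -> V) (p d : V) : ProperFilter U ->
  maximally_monotone ip A -> monotone_op ip D -> 0 <= l ->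
  (forall v w, N (D v - D w) <= l * N (v - w)) ->
  (forall n, A (y n) (a n)) -> (forall n, N (y n) <= K) ->
  weak_lim U y p -> weak_lim U (D \o y) d ->
  N (a n + D (y n)) @[n --> U] --> (0 : R) ->
  A p (- D p).
Proof.
move=> UU HA Dm l0 Dl Ay yK yp Dyd r0.
have rq q : ip (a n + D (y n)) (y n - q) @[n --> U] --> (0 : R).
  apply: (@ip_cvg0 _ _ _ (K + N q)) => // n.
  by rewrite (le_trans (ler_hnormB ipH.1 _ _))// lerD2r.
have yq w q : ip (y n) w - ip q w @[n --> U] --> ip p w - ip q w.
  by apply: cvgB; [exact: yp|exact: cvg_cst].
have Apd : A p (- d).
  apply: maximal_mem => // q b Aqb.
  (* This shape is the termwise limit of [h], whose sequence equals [<y_n - q, a_n - b> + <y_n - p,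
     D y_n - D p>], a sum of two nonnegative terms. *)
  have -> : ip (q - p) (b - - d) = 0 - (ip p (D p) - ip p (D p))
      - ip d (p - q) - (ip p b - ip q b).
    by rewrite !ipE (ipC ipH.1 d p) (ipC ipH.1 d q); ring.
  have h : ip (a n + D (y n)) (y n - q) - (ip (y n) (D p) - ip p (D p))
      - ip (D (y n)) (p - q) - (ip (y n) b - ip q b) @[n --> U] -->
      0 - (ip p (D p) - ip p (D p)) - ip d (p - q) - (ip p b - ip q b).
    apply: cvgB => //; apply: cvgB; last exact: Dyd.
    by apply: cvgB.
  apply: (cvgr_to_ge h); apply: nearW => n.
  have := HA.1 _ _ _ _ (Ay n) Aqb; have := Dm (y n) p.
  rewrite !ipE !(ipC ipH.1 (D _)) !(ipC ipH.1 (a _)).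
  by lra.
have dq q : 0 <= ip (p - q) (d - D q).
  (* Same device: here the sequence equals [<y_n - p, a_n + d> + <y_n - q, D y_n - D q>]. *)
  have -> : ip (p - q) (d - D q) = 0 + (ip p d - ip p d) + ip d (p - q)
      - (ip p (D q) - ip q (D q)).
    by rewrite !ipE (ipC ipH.1 d p) (ipC ipH.1 d q); ring.
  have h : ip (a n + D (y n)) (y n - p) + (ip (y n) d - ip p d)
      + ip (D (y n)) (p - q) - (ip (y n) (D q) - ip q (D q)) @[n --> U] -->
      0 + (ip p d - ip p d) + ip d (p - q) - (ip p (D q) - ip q (D q)).
    apply: cvgB => //; apply: cvgD; last exact: Dyd.
    by apply: cvgD.
  apply: (cvgr_to_ge h); apply: nearW => n.
  have := HA.1 _ _ _ _ (Ay n) Apd; have := Dm (y n) q.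
  rewrite !ipE !(ipC ipH.1 (D _)) !(ipC ipH.1 (a _)).
  by lra.
suff -> : D p = d by [].
set h := d - D p.
suff /(ip_eq0 ipH.1)/subr0_eq : ip h h = 0 by move=> ->.
suff : - ip h h = 0 by lra.
(* Testing [dq] at [p + t h] gives [- t |h|^2] plus an error that the Lipschitz bound makes
   quadratic in [t]. *)
apply: (@quadratic_ge0_linear0 _ (l * ip h h)).
  by rewrite mulr_ge0// ip_ge0//; exact: ipH.1.
move=> t; have := dq (p + t *: h).
have -> : p - (p + t *: h) = - t *: h by rewrite opprD addNKr scaleNr.
have -> : d - D (p + t *: h) = h + (D p - D (p + t *: h)).
  by rewrite /h addrA subrK.
rewrite ipDr//; last exact: ipH.1.
rewrite (ipZl ipH.1 _ h h) => /le_trans; apply.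
suff : ip (- t *: h) (D p - D (p + t *: h)) <= t ^+ 2 * (l * ip h h) by lra.
apply: le_trans (ip_le ipH.1 _ _) _.
have := Dl p (p + t *: h).
have -> : p - (p + t *: h) = - t *: h by rewrite opprD addNKr scaleNr.
move=> /(ler_wpM2l (hnorm_ge0 ip (- t *: h))) /le_trans; apply.
rewrite mulrCA -expr2 hnorm_sqr ?ipE; last exact: ipH.1.
by rewrite le_eqVlt; apply/orP; left; apply/eqP; ring.
Qed.

(** For two weak limits [z], [z'] in [P], the difference of the squared distances to them is affine
    in [x n], so [<x n, z - z'>] converges. Its limit is both [<z, z - z'>] and [<z', z - z'>],
    whence [z = z']. *)
Lemma opial (P : set V) (x : nat -> V) (K : R) :
  (forall n, N (x n) <= K) ->
  (forall U, UltraFilter U -> \oo `<=` U -> forall z, weak_lim U x z -> P z) ->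
  (forall z, P z -> cvgn (fun n => ip (x n - z) (x n - z))) ->
  exists z, P z /\ weak_cvg ip x z.
Proof.
move=> xK cluP dcvg.
have [U [UU Uoo]] := ultraFilterLemma (eventually_filter : ProperFilter \oo).
have [z zU] := ultra_weak_lim UU xK.
have Pz := cluP _ UU Uoo _ zU; exists z; split => // w.
apply/cvgrPdist_lt => e e0; apply: contrapT => nconv.
(* If convergence fails, the indices in [B] recur infinitely often; an ultrafilter containing [B]
   yields a second weak limit, whose equality with [z] is absurd on [B]. *)
pose B := [set n | ~ `|ip z w - ip (x n) w| < e].
have PB : ProperFilter (within B \oo).
  apply: Build_ProperFilter.
  move=> h; have h1 : \forall n \near \oo, B n -> False by [].
  by apply: nconv; apply: filterS h1 => n /contrapT.
have [U' [UU' U'B]] := ultraFilterLemma PB.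
have U'oo : \oo `<=` U' by move=> Q Qoo; apply: U'B; apply: filterS Qoo => n Qn _.
have [z' zU'] := ultra_weak_lim UU' xK.
have Pz' := cluP _ UU' U'oo _ zU'.
have hd : cvgn (fun n => ip (x n) (z - z')).
  have -> : (fun n => ip (x n) (z - z')) =
      (fun n => (ip (x n - z') (x n - z') - ip (x n - z) (x n - z)
                 + (ip z z - ip z' z')) * 2^-1).
    apply/funext => n; rewrite !ipE !(ipC ipH.1 _ (x n)); lra.
  apply: is_cvgMr_tmp; apply: is_cvgD; last exact: is_cvg_cst.
  by apply: is_cvgB; exact: dcvg.
have e1 := cvg_unique (@norm_hausdorff _ R) (zU _) (cvg_trans (cvg_app _ Uoo) hd).
have e2 := cvg_unique (@norm_hausdorff _ R) (zU' _) (cvg_trans (cvg_app _ U'oo) hd).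
have zz' : z = z'.
  by apply/subr0_eq/(ip_eq0 ipH.1); rewrite ipDl ?ipNl ?e1 ?e2 ?subrr//; exact: ipH.1.
have U'lim : \forall n \near U', `|ip z w - ip (x n) w| < e.
  by rewrite zz'; move/cvgrPdist_lt : (zU' w); apply.
have U'nB : U' B by apply: U'B; apply: nearW.
by have [n [? ]] := filter_ex (filterI U'lim U'nB); apply.
Qed.

End WeakLimits.

(** * Lyapunov descent and weak convergence in the case [S = id] *)

Section Convergence.
Variables (R : realType) (V : lmodType R) (ip : V -> V -> R).
Hypothesis ipH : hilbert_space ip.
Local Notation N := (hnorm ip).
Local Notation ipE := (ipE ipH.1).

Lemma cocoercive_lipschitz (beta : R) (C : V -> V) : 0 < beta ->
  (forall v w, beta^-1 * N (C v - C w) ^+ 2 <= ip (C v - C w) (v - w)) ->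
  forall v w, N (C v - C w) <= beta * N (v - w).
Proof.
move=> b0 HC v w; have := le_trans (HC v w) (ip_le ipH.1 _ _).
have := hnorm_ge0 ip (C v - C w); have := hnorm_ge0 ip (v - w).
rewrite ler_pdivrMl//; move: (N (v - w)) (N (C v - C w)) => s t s0 t0 h.
rewrite leNgt; apply/negP => st; have t1 : 0 < t by rewrite (le_lt_trans _ st)// mulr_ge0// ltW.
by nra.
Qed.

(** [Lp] and [dp] are the previous Lipschitz constant and residual. Besides [L] from the left side,
    the coefficient loses [Lp] to Young's inequality on [<u, y - x>], [2 g L mu] to [<u', x' - y>],
    [g^2 mu^2] to [|x' - y|^2] and [g beta / 2] to [C]. *)
Lemma descent_step (A : V -> set V) (B C : V -> V) (mu beta g L Lp dp : R)
    (x y u u' x' z : V) :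
  monotone_setop ip A -> monotone_op ip B -> 0 <= mu -> 0 < beta -> 0 < g ->
  0 <= L -> 0 <= Lp -> 0 <= dp ->
  (forall v w, N (B v - B w) <= mu * N (v - w)) ->
  (forall v w, beta^-1 * N (C v - C w) ^+ 2 <= ip (C v - C w) (v - w)) ->
  A z (- (B z + C z)) ->
  A y (g^-1 *: (x - y + (u - u')) - (B x + C x)) ->
  x' = y - g *: (B y - B x) ->
  N u <= Lp * dp -> N u' <= L * N (y - x) ->
  N (x' - z) ^+ 2 + 2 * ip u' (x' - z) + L * N (y - x) ^+ 2 <=
  N (x - z) ^+ 2 + 2 * ip u (x - z) + Lp * dp ^+ 2
  - (1 - Lp - L - 2 * g * L * mu - g ^+ 2 * mu ^+ 2 - g * beta / 2)
    * N (y - x) ^+ 2.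
Proof.
move=> Am Bm mu0 beta0 g0 L0 Lp0 dp0 Bl HC Az Ay x'E hu hu'.
have d0 : 0 <= N (y - x) := hnorm_ge0 _ _.
have b0 : 0 <= N (B y - B x) := hnorm_ge0 _ _.
have c0 : 0 <= N (C x - C z) := hnorm_ge0 _ _.
have mA : 0 <= ip (y - z) (x - y + (u - u')) - g * ip (y - z) (B x + C x - (B z + C z)).
  have := mulr_ge0 (ltW g0) (Am _ _ _ _ Ay Az).
  have -> : g^-1 *: (x - y + (u - u')) - (B x + C x) - - (B z + C z) =
     g^-1 *: (x - y + (u - u')) - (B x + C x - (B z + C z)).
    by rewrite opprK opprB [LHS]addrAC [RHS]addrA.
  by rewrite (ipDr ipH.1 (g^-1 *: _)) (ipZr ipH.1) (ipNr ipH.1) mulrDr mulVKf ?gt_eqF// mulrN.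
have mB := mulr_ge0 (ltW g0) (Bm y z).
(* [C] is evaluated at [x] but paired with [y - z]; splitting off [y - x] and completing the square
   against cocoercivity costs [beta / 4]. *)
have mC : - (g * (beta / 4 * N (y - x) ^+ 2)) <= g * ip (C x - C z) (y - z).
  rewrite -mulrN ler_pM2l//.
  have -> : ip (C x - C z) (y - z) = ip (C x - C z) (x - z) + ip (C x - C z) (y - x).
    by rewrite !ipE; ring.
  have := HC x z; have := ip_ge ipH.1 (C x - C z) (y - x).
  have := mulr_ge0 (ltW (divr_gt0 ltr01 beta0))
    (sqr_ge0 (N (C x - C z) - beta / 2 * N (y - x))).
  have -> : 1 / beta * (N (C x - C z) - beta / 2 * N (y - x)) ^+ 2 =
     beta^-1 * N (C x - C z) ^+ 2 - N (C x - C z) * N (y - x)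
     + beta / 4 * N (y - x) ^+ 2 by field; rewrite gt_eqF.
  by lra.
have mBl : g ^+ 2 * ip (B y - B x) (B y - B x) <= g ^+ 2 * (mu ^+ 2 * N (y - x) ^+ 2).
  rewrite ler_pM2l ?exprn_gt0// -(hnorm_sqr ipH.1) -exprMn.
  by rewrite ler_sqr ?nnegrE ?mulr_ge0.
have mu1 : 2 * ip u (y - x) <= Lp * dp ^+ 2 + Lp * N (y - x) ^+ 2.
  have h := ip_le ipH.1 u (y - x); have h1 := ler_wpM2r d0 hu.
  have := mulr_ge0 Lp0 (sqr_ge0 (dp - N (y - x))).
  by lra.
have mu2 : - (2 * (g * ip u' (B y - B x))) <= 2 * (g * (L * mu * N (y - x) ^+ 2)).
  rewrite -mulrN ler_pM2l// -mulrN ler_pM2l//.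
  have h := ip_ge ipH.1 u' (B y - B x).
  have := ler_pM (hnorm_ge0 ip u') b0 hu' (Bl y x).
  by lra.
move: mA mB mC mBl mu1 mu2; rewrite -!(hnorm_sqr ipH.1) x'E.
rewrite !(hnorm_sqr ipH.1) !ipE.
(* Symmetric inner products are oriented one way; the claim is then the sum of the estimates, with
   [mA], [mB] and [mC] taken twice. *)
rewrite !(ipC ipH.1 _ x) !(ipC ipH.1 _ y) !(ipC ipH.1 _ z) !(ipC ipH.1 _ u).
rewrite !(ipC ipH.1 _ u') !(ipC ipH.1 (B y) (B x)).
by lra.
Qed.

Variables (A : V -> set V) (B C : V -> V) (mu beta gamma eps : R).
Variables (gam L : nat -> R) (x y u : nat -> V).
Hypotheses (HA : maximally_monotone ip A) (HBm : monotone_op ip B).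
Hypotheses (mu0 : 0 <= mu) (beta0 : 0 < beta) (gamma0 : 0 < gamma) (eps0 : 0 < eps).
Hypothesis HBl : forall v w, N (B v - B w) <= mu * N (v - w).
Hypothesis HC :
  forall v w, beta^-1 * N (C v - C w) ^+ 2 <= ip (C v - C w) (v - w).
Hypothesis Hgam : forall k, gamma <= gam k.
Hypothesis HL : forall k, 0 <= L k < 1.
Hypothesis Hcond : forall k, eps <= 1 - L k - L k.+1 - 2 * gam k.+1 * L k.+1 * mu
  - gam k.+1 ^+ 2 * mu ^+ 2 - gam k.+1 * beta / 2.
(** The resolvent inclusion with [M k] eliminated: for [S = id], [gam k (M k (x k) - M k (y k))] is
    [x k - y k - u k.+1]. *)
Let a k := (gam k)^-1 *: (x k - y k + (u k - u k.+1)) - (B (x k) + C (x k)).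
Hypothesis Ay : forall k, A (y k) (a k).
Hypothesis xS : forall k, x k.+1 = y k - gam k *: (B (y k) - B (x k)).
Hypothesis uS : forall k, N (u k.+1) <= L k * N (y k - x k).
Let d k := N (y k - x k).

Let gam_gt0 k : 0 < gam k. Proof. exact: lt_le_trans (Hgam k). Qed.
Let L_ge0 k : 0 <= L k. Proof. by have /andP[] := HL k. Qed.
Let L_lt1 k : L k < 1. Proof. by have /andP[] := HL k. Qed.
Let d_ge0 k : 0 <= d k. Proof. exact: hnorm_ge0. Qed.

(** Shifted by one from the usual indexing: [u 0] is arbitrary, and [uS] controls [u] only from
    index 1 on. *)
Let phi z k := N (x k.+1 - z) ^+ 2 + 2 * ip (u k.+1) (x k.+1 - z) + L k * d k ^+ 2.

Lemma phi_descent z k : A z (- (B z + C z)) ->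
  phi z k.+1 <= phi z k - eps * d k.+1 ^+ 2.
Proof.
move=> Az; have := descent_step HA.1 HBm mu0 beta0 (gam_gt0 k.+1) (L_ge0 k.+1)
  (L_ge0 k) (d_ge0 k) HBl HC Az (Ay k.+1) (xS k.+1) (uS k) (uS k.+1).
have := ler_wpM2r (sqr_ge0 (d k.+1)) (Hcond k).
by rewrite /phi -/(d k.+1); lra.
Qed.

(** Young's inequality on the cross term leaves [1 - L k] in front of the squared distance, and the
    step-size condition bounds this below by [eps]. *)
Lemma phi_ge z k : eps * N (x k.+1 - z) ^+ 2 <= phi z k.
Proof.
have Le : eps <= 1 - L k.
  have h1 := L_ge0 k.+1; have h2 := mulr_ge0 (mulr_ge0 (ltW (gam_gt0 k.+1)) h1) mu0.
  have h3 := mulr_ge0 (sqr_ge0 (gam k.+1)) (sqr_ge0 mu).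
  have h4 := mulr_ge0 (ltW (gam_gt0 k.+1)) (ltW beta0).
  by have := Hcond k; lra.
have h1 := ler_wpM2r (sqr_ge0 (N (x k.+1 - z))) Le.
have h2 := ip_ge ipH.1 (u k.+1) (x k.+1 - z).
have h3 := ler_wpM2r (hnorm_ge0 ip (x k.+1 - z)) (uS k).
have h4 := mulr_ge0 (L_ge0 k) (sqr_ge0 (d k - N (x k.+1 - z))).
by rewrite /phi; move: h3 h4; rewrite -/(d k); lra.
Qed.

Lemma phi_ge0 z k : 0 <= phi z k.
Proof. by apply: le_trans (phi_ge z k); rewrite mulr_ge0 ?sqr_ge0 ?ltW. Qed.

Section Zero.
Variable z : V.
Hypothesis Az : A z (- (B z + C z)).

Lemma phi_nonincreasing : {homo phi z : n m / (n <= m)%N >-> m <= n}.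
Proof.
apply/nonincreasing_seqP => n; apply: le_trans (phi_descent _ Az) _.
by rewrite gerBl mulr_ge0 ?sqr_ge0 ?ltW.
Qed.

Lemma phi_cvg : cvgn (phi z).
Proof.
apply: nonincreasing_is_cvgn; first exact: phi_nonincreasing.
by exists 0 => _ [n _ <-]; exact: phi_ge0.
Qed.

Lemma dist_bounded : exists K, forall n, N (x n.+1 - z) <= K /\ d n.+1 <= K.
Proof.
(* [t^2 <= c] implies [t <= 1 + c], which avoids a square root. *)
exists (1 + phi z 0 / eps) => n.
have h (t : R) : 0 <= t -> eps * t ^+ 2 <= phi z 0 -> t <= 1 + phi z 0 / eps.
  move=> t0 ht; have : t ^+ 2 <= phi z 0 / eps by rewrite ler_pdivlMr// mulrC.
  by have := sqr_ge0 (t - 1); nra.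
have := phi_nonincreasing (leq0n n); split; apply: h; rewrite ?hnorm_ge0//.
  exact: le_trans (phi_ge z n) _.
by have := phi_descent n Az; have := phi_ge0 z n.+1; lra.
Qed.

(** [eps d^2] is at most the drop of [phi], and consecutive differences of a convergent sequence
    vanish. *)
Lemma residual_cvg0 : d n @[n --> \oo] --> (0 : R).
Proof.
have h : d n.+1 ^+ 2 @[n --> \oo] --> (0 : R).
  apply: (@squeeze_cvgr _ _ _ _ (fun=> 0) (fun n => (phi z n - phi z n.+1) * eps^-1)).
  - apply: nearW => n; rewrite sqr_ge0/= ler_pdivlMr//.
    by have := phi_descent n Az; lra.
  - exact: cvg_cst.
  - rewrite -(mul0r eps^-1) -(subrr (limn (phi z))).
    apply: cvgMr_tmp; apply: cvgB; first exact: phi_cvg.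
    by have := phi_cvg; rewrite -(cvg_shiftS (phi z)).
have h1 : Num.sqrt (d n.+1 ^+ 2) @[n --> \oo] --> Num.sqrt (0 : R).
  exact: continuous_cvg _ (@sqrt_continuous R 0) h.
have e : (fun n => Num.sqrt (d n.+1 ^+ 2)) = (fun n => d n.+1).
  by apply/funext => n; rewrite sqrtr_sqr ger0_norm.
by rewrite -(cvg_shiftS d); move: h1; rewrite e sqrtr0.
Qed.

Lemma u_cvg0 : N (u n.+1) @[n --> \oo] --> (0 : R).
Proof.
apply: (@squeeze_cvgr _ _ _ _ (fun=> 0) d).
- apply: nearW => n; rewrite hnorm_ge0 (le_trans (uS n))//.
  by apply: ler_piMl; [exact: hnorm_ge0 | exact: ltW].
- exact: cvg_cst.
- exact: residual_cvg0.
Qed.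

(** The squared distance is [phi] minus two terms that tend to 0. *)
Lemma dist_cvg : cvgn (fun n => ip (x n.+1 - z) (x n.+1 - z)).
Proof.
have [K hK] := dist_bounded.
have uz : ip (u n.+1) (x n.+1 - z) @[n --> \oo] --> (0 : R).
  by apply: (ip_cvg0 (K := K) ipH _ u_cvg0) => n; have [] := hK n.
have Ld : L n * d n ^+ 2 @[n --> \oo] --> (0 : R).
  apply: (@squeeze_cvgr _ _ _ _ (fun=> 0) (fun n => d n * d n)).
  - apply: nearW => n; rewrite mulr_ge0 ?sqr_ge0//= -expr2 ler_piMl ?sqr_ge0//.
    by rewrite ltW.
  - exact: cvg_cst.
  - by rewrite -(mul0r (0 : R)); apply: cvgM; exact: residual_cvg0.
have -> : (fun n => ip (x n.+1 - z) (x n.+1 - z)) =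
    (fun n => phi z n - 2 * ip (u n.+1) (x n.+1 - z) - L n * d n ^+ 2).
  by apply/funext => n; rewrite /phi (hnorm_sqr ipH.1); ring.
apply: is_cvgB; last by apply/cvg_ex; exists 0.
apply: is_cvgB; first exact: phi_cvg.
by apply: is_cvgMl_tmp; apply/cvg_ex; exists 0.
Qed.

End Zero.

Lemma nfbhf_weak_cvg : (exists z, zer3 A B C z) ->
  exists z, zer3 A B C z /\ weak_cvg ip x z.
Proof.
pose D v := B v + C v.
have zerE z : zer3 A B C z <-> A z (- D z).
  split=> [[b [Ab]]|h]; last by exists (- D z); rewrite -addrA addNr.
  by rewrite -addrA => /eqP; rewrite addr_eq0 => /eqP <-.
move=> [z0 /zerE Az0].
have Cl := cocoercive_lipschitz beta0 HC.
have Dm : monotone_op ip D.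
  move=> v w; have := HBm v w; have := HC v w.
  have : 0 <= beta^-1 * N (C v - C w) ^+ 2 by rewrite mulr_ge0 ?sqr_ge0// invr_ge0 ltW.
  by rewrite /D !ipE; lra.
have Dl v w : N (D v - D w) <= (mu + beta) * N (v - w).
  have -> : D v - D w = B v - B w + (C v - C w) by rewrite /D opprD addrACA.
  by rewrite (le_trans (ler_hnormD ipH.1 _ _))// mulrDl lerD.
have [K hK] := dist_bounded Az0.
have xK n : N (x n.+1) <= K + N z0.
  rewrite -[x n.+1](subrK z0) (le_trans (ler_hnormD ipH.1 _ _))// lerD2r.
  by have [] := hK n.
have yK n : N (y n.+1) <= K + (K + N z0).
  rewrite -[y n.+1](subrK (x n.+1)) (le_trans (ler_hnormD ipH.1 _ _))// lerD//.
  by have [] := hK n.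
have DyK n : N (D (y n.+1)) <= (mu + beta) * (K + (K + N z0)) + N (D 0).
  rewrite -[D (y n.+1)](subrK (D 0)) (le_trans (ler_hnormD ipH.1 _ _))// lerD2r.
  rewrite (le_trans (Dl _ _))// subr0 ler_wpM2l// addr_ge0// ltW//.
have d0 := residual_cvg0 Az0.
have dS0 : d n.+1 @[n --> \oo] --> (0 : R) by have := d0; rewrite -(cvg_shiftS d).
(* The residual is [(x - y + u - u') / gam k] plus [D y - D x]; the lower bound [gamma] keeps
   [1 / gam k] bounded, and the two [u] terms contribute [d n] and [d n.+1]. *)
have r0 : N (a n.+1 + D (y n.+1)) @[n --> \oo] --> (0 : R).
  apply: (@squeeze_cvgr _ _ _ _ (fun=> 0)
    (fun n => gamma^-1 * (d n.+1 + (d n + d n.+1)) + (mu + beta) * d n.+1)).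
  - apply: nearW => n; rewrite hnorm_ge0/=; set k := n.+1.
    have -> : a k + D (y k) = (gam k)^-1 *: (x k - y k + (u k - u k.+1)) + (D (y k) - D (x k)).
      by rewrite /a addrAC -!addrA.
    rewrite (le_trans (ler_hnormD ipH.1 _ _))// lerD//.
    rewrite (hnormZ ipH.1) gtr0_norm ?invr_gt0//.
    apply: ler_pM; rewrite ?invr_ge0 ?hnorm_ge0//.
    + exact: ltW.
    + by rewrite lef_pV2 ?posrE.
    rewrite (le_trans (ler_hnormD ipH.1 _ _))// lerD//.
      by rewrite (hnorm_distC ipH.1).
    rewrite (le_trans (ler_hnormB ipH.1 _ _))// lerD//.
      rewrite (le_trans (uS _))//.
      by apply: ler_piMl; [exact: hnorm_ge0 | exact: ltW].
    rewrite (le_trans (uS _))//.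
    by apply: ler_piMl; [exact: hnorm_ge0 | exact: ltW].
  - exact: cvg_cst.
  - have -> : (0 : R) = gamma^-1 * (0 + (0 + 0)) + (mu + beta) * 0 by rewrite !addr0 !mulr0 addr0.
    by apply: cvgD; apply: cvgMl_tmp => //; apply: cvgD => //; apply: cvgD.
(* Opial is applied to the shifted sequence because the bounds start at index 1. *)
have [||z [/zerE Az zx]] := @opial _ _ _ ipH (fun z => zer3 A B C z) (fun n => x n.+1) _ xK.
- move=> U UU Uoo z zx; apply/zerE.
  have yz : weak_lim ip U (fun n => y n.+1) z.
    move=> w.
    have -> : (fun n => ip (y n.+1) w) = (fun n => ip (y n.+1 - x n.+1) w + ip (x n.+1) w).
      by apply/funext => n; rewrite -(ipDl ipH.1) subrK.
    rewrite -[ip z w]add0r; apply: cvgD; last exact: zx.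
    apply: (@ip_cvg0 _ _ _ ipH _ _ (fun=> w) (N w)) => //.
    exact: cvg_trans (cvg_app _ Uoo) dS0.
  have [e ez] := ultra_weak_lim ipH UU DyK.
  apply: (demiclosed ipH _ HA Dm _ Dl (fun n => Ay n.+1) yK yz ez).
    by rewrite addr_ge0// ltW.
  exact: cvg_trans (cvg_app _ Uoo) r0.
- by move=> z /zerE; exact: dist_cvg.
exists z; split; first exact/zerE.
by move=> w; have := zx w; rewrite -(cvg_shiftS (fun k => ip (x k) w)).
Qed.

End Convergence.

(** * The equivalent inner product [<S x, y>] *)

Section Renorm.
Variables (R : realType) (V : lmodType R) (inner : V -> V -> R) (S Sinv : V -> V).
Hypotheses (HV : hilbert_space inner) (HS : in_P inner S).
Hypotheses (SK : cancel S Sinv) (SinvK : cancel Sinv S).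

Definition renorm (x y : V) : R := inner (S x) y.

Lemma S_linear a x y : S (a *: x + y) = a *: S x + S y.
Proof. by case: HS => -[]. Qed.

Lemma S_symmetric x y : inner (S x) y = inner x (S y).
Proof. by case: HS. Qed.

Lemma S0 : S 0 = 0.
Proof.
have := S_linear 1 0 0; rewrite !scale1r addr0 => h.
by apply: (addrI (S 0)); rewrite addr0 -h.
Qed.

Lemma SD x y : S (x + y) = S x + S y.
Proof. by have := S_linear 1 x y; rewrite !scale1r. Qed.

Lemma SZ a x : S (a *: x) = a *: S x.
Proof. by have := S_linear a x 0; rewrite S0 !addr0. Qed.

Lemma SN x : S (- x) = - S x. Proof. by rewrite -scaleN1r SZ scaleN1r. Qed.

Definition SE := (S0, SD, SZ, SN, SinvK).

Lemma S_inj x y : S x = S y -> x = y. Proof. exact: (can_inj SK). Qed.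

Lemma SinvB x y : Sinv (x - y) = Sinv x - Sinv y.
Proof. by apply: S_inj; rewrite !SE. Qed.

(** Turns the mixed-norm Lipschitz and cocoercivity hypotheses into ordinary ones for the images
    under [Sinv]. *)
Lemma Snorm_Sinv_renorm v : Snorm inner Sinv v = hnorm renorm (Sinv v).
Proof. by rewrite /Snorm /hnorm /renorm SinvK (ipC HV.1). Qed.

Lemma renorm_inner_product : inner_product renorm.
Proof.
have [_ _ [m [m0 hm]]] := HS; split.
- by move=> x y; rewrite /renorm S_symmetric (ipC HV.1).
- by move=> a x y z; rewrite /renorm S_linear (ip_linear HV.1).
- by move=> x; apply: le_trans (hm x); rewrite mulr_ge0 ?sqr_ge0 ?ltW.
move=> x; rewrite /renorm => x0; have := hm x.
rewrite x0 pmulr_rle0// (hnorm_sqr HV.1) => h.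
by apply: (ip_eq0 HV.1); apply/eqP; rewrite eq_le h (ip_ge0 HV.1).
Qed.

Lemma hnorm_le_renorm : exists2 K, 0 < K & forall x, hnorm inner x <= K * hnorm renorm x.
Proof.
(* The square of [1 + m^-1] dominates [m^-1], so no square root of [m] appears. *)
have [_ _ [m [m0 hm]]] := HS; exists (1 + m^-1) => [|x].
  by rewrite addr_gt0// invr_gt0.
have mi0 : 0 <= m^-1 by rewrite invr_ge0 ltW.
rewrite -ler_sqr ?nnegrE ?mulr_ge0 ?hnorm_ge0 ?addr_ge0// exprMn.
have : hnorm inner x ^+ 2 <= m^-1 * hnorm renorm x ^+ 2.
  by rewrite ler_pdivlMl// (hnorm_sqr renorm_inner_product); exact: hm.
move=> /le_trans; apply; rewrite ler_wpM2r ?sqr_ge0//.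
by have := sqr_ge0 m^-1; lra.
Qed.

Lemma renorm_le_hnorm : exists2 K, 0 < K & forall x, hnorm renorm x <= K * hnorm inner x.
Proof.
have [[_ [c hc]] _ _] := HS; exists (1 + `|c|) => [|x].
  by rewrite ltr_pwDl.
have c0 := normr_ge0 c; have N0 := hnorm_ge0 inner x.
rewrite -ler_sqr ?nnegrE ?mulr_ge0 ?hnorm_ge0 ?addr_ge0// exprMn.
rewrite (hnorm_sqr renorm_inner_product).
apply: le_trans (ip_le HV.1 _ _) _.
apply: (@le_trans _ _ (`|c| * hnorm inner x ^+ 2)).
  rewrite expr2 mulrA ler_wpM2r// (le_trans (hc x))// ler_wpM2r// ler_norm//.
by rewrite ler_wpM2r ?sqr_ge0//; have := sqr_ge0 `|c|; lra.
Qed.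

Lemma renorm_hilbert : hilbert_space renorm.
Proof.
split; first exact: renorm_inner_product.
have [K1 K10 hK1] := hnorm_le_renorm; have [K2 K20 hK2] := renorm_le_hnorm.
move=> u uC; have [|l lP] := HV.2 u.
  move=> e e0; have [n hn] := uC (e / K1) (divr_gt0 e0 K10); exists n => p q np nq.
  by rewrite (le_lt_trans (hK1 _))// mulrC -ltr_pdivlMr// hn.
exists l => e e0; have [n hn] := lP (e / K2) (divr_gt0 e0 K20); exists n => p np.
by rewrite (le_lt_trans (hK2 _))// mulrC -ltr_pdivlMr// hn.
Qed.

(** The factor [S] of the new inner product cancels the [Sinv] applied to values, so monotone
    extensions correspond on both sides. *)
Lemma renorm_maximally_monotone (A : V -> set V) : maximally_monotone inner A ->
  maximally_monotone renorm (fun x => [set v | A x (S v)]).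
Proof.
move=> [Am AM]; split.
  move=> x y u v /= Au Av; rewrite /renorm S_symmetric SD SN; exact: Am.
move=> A' A'm sub x v A'xv /=.
apply: (AM (fun y w => A' y (Sinv w))); rewrite ?SK//.
  move=> y z w t hw ht; have := A'm _ _ _ _ hw ht.
  by rewrite /renorm S_symmetric !SE.
by move=> y w Ayw; apply: sub; rewrite /= SinvK.
Qed.

Lemma weak_cvg_renorm (x : nat -> V) z : weak_cvg renorm x z -> weak_cvg inner x z.
Proof.
move=> h w; have := h (Sinv w); rewrite /renorm S_symmetric SinvK.
have -> // : (fun k => inner (S (x k)) (Sinv w)) = (fun k => inner (x k) w).
by apply/funext => k; rewrite S_symmetric SinvK.
Qed.

End Renorm.

(** * Transfer of the case [S = id] to a general metric *)

Theorem theorem3p1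
  (R : realType) (V : lmodType R) (inner : V -> V -> R)
  (HV : hilbert_space inner)
  (* Assumption (A1) *)
  (S Sinv : V -> V) (HS : in_P inner S)
  (HSinv : cancel S Sinv /\ cancel Sinv S)
  (A : V -> set V) (B C : V -> V) (mu beta : R)
  (HA : maximally_monotone inner A)
  (Hmu : 0 <= mu) (HBm : monotone_op inner B)
  (HBl : lipschitz_wrt inner S Sinv mu B)
  (Hbeta : 0 < beta) (HC : cocoercive_wrt inner Sinv beta C)
  (Hzer : exists z, zer3 A B C z)
  (gamma : R) (gam : nat -> R) (L : nat -> R) (M : nat -> V -> V)
  (Hgamma : 0 < gamma) (Hgam : forall k, gamma <= gam k)
  (HL : forall k, 0 <= L k < 1)
  (HM : forall k, lipschitz_wrt inner S Sinv (L k)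
                    (fun v => gam k *: M k v - S v))
  (* step-size condition *)
  (eps : R) (Heps : 0 < eps)
  (Hcond : forall k : nat, (1 <= k)%N ->
     eps <= 1 - L k.-1 - L k - 2 * gam k * L k * mu - gam k ^+ 2 * mu ^+ 2
            - gam k * beta / 2)
  (* the algorithm *)
  (x0 u0 : V) (x y u : nat -> V)
  (Halg : NFBHF_M Sinv A B C gam M S x0 u0 x y u) :
  exists z, zer3 A B C z /\ weak_cvg inner x z.
Proof.
have [SK SinvK] := HSinv; have rH := renorm_hilbert HV HS.
have SlE := SE HS SinvK; have SnE := Snorm_Sinv_renorm HV SinvK.
have SiB := SinvB HS SK SinvK; have Sy := S_symmetric HS.
pose A' := fun v : V => [set w | A v (S w)].
have zerE z : zer3 A' (Sinv \o B) (Sinv \o C) z <-> zer3 A B C z.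
  split=> -[a [Aa a0]].
    by exists (S a); split => //; have := congr1 S a0; rewrite !SlE.
  exists (Sinv a); split; first by rewrite /A' /= SinvK.
  by apply: (can_inj SK); rewrite !SlE.
have [x00 u00 alg] := Halg.
suff [z [/zerE Pz xz]] : exists z,
    zer3 A' (Sinv \o B) (Sinv \o C) z /\ weak_cvg (renorm inner S) x z.
  by exists z; split => //; exact: (weak_cvg_renorm HS SinvK xz).
apply: (nfbhf_weak_cvg rH (gam := gam) (L := L) (y := y) (u := Sinv \o u)
  (renorm_maximally_monotone HS SK SinvK HA) _ Hmu Hbeta Hgamma Heps _ _ Hgam HL).
- by move=> v w; rewrite /renorm /= -SiB SinvK; exact: HBm.
- by move=> v w; rewrite /= -SiB -SnE; exact: HBl.
- by move=> v w; rewrite /= -SiB -SnE /renorm SinvK; exact: HC.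
- by move=> k; exact: (Hcond k.+1).
- move=> k /=; have [Ay _ uE] := alg k.
  have g0 : gam k != 0 by rewrite gt_eqF// (lt_le_trans Hgamma).
  rewrite /A' /= !SlE uE; move: Ay; rewrite /resolvent_point; congr A.
  (* Pairing with an arbitrary [w] turns the vector identity that eliminates [M k] into a scalar
     one. *)
  apply: (ip_ext HV.1) => w; rewrite !(ipE HV.1).
  by field.
- by move=> k; have [_ -> _] := alg k; rewrite /= scalerBr opprB addrA addrAC.
- by move=> k; have [_ _ uE] := alg k; rewrite /= uE -SnE; exact: HM.
- by have [z Pz] := Hzer; exists z; exact/zerE.
Qed.
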